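(* Let $N,m>1$ be integers. Let $f:\mathbb{Z}/N\mathbb{Z}\to\mu_m\cup\{0\}$ have order $m$, with $f(1)=1$ and $f(n)=0$ if and only if $\gcd(n,N)>1$. Put $d=\gcd(m,N)$, and let $H\le(\mathbb{Z}/m\mathbb{Z})^\times$ be a subgroup such that the reduction map $\pi:H\to(\mathbb{Z}/d\mathbb{Z})^\times$ is surjective. Assume that for each $c\in H$ there exists $\lambda_c\in\mathbb{C}^\times$ such that $$\widehat{f^c}(\xi)=\lambda_c\,\overline{f^c(\xi)}\qquad\text{for all }\xi\in\mathbb{Z}/N\mathbb{Z}.$$ Then $f$ is a primitive Dirichlet character modulo $N$. Furthermore, if $\gcd(m,N)=1$, then $N$ is odd and squarefree.
   Context: $\mu_m\subset\mathbb{C}$ is the set of $m$-th roots of unity, and $e(x):=e^{2\pi i x}$. ''$f$ has order $m$'' means that $m$ is the minimal positive integer such that $f(x)\in\mu_m$ for all $x\in(\mathbb{Z}/N\mathbb{Z})^\times$. For $c\in(\mathbb{Z}/m\mathbb{Z})^\times$, $f^c(x):=f(x)^c$ when $\gcd(x,N)=1$ and $f^c(x):=0$ otherwise. For $g:\mathbb{Z}/N\mathbb{Z}\to\mathbb{C}$ the normalized Fourier transform is $$\hat g(\xi):=\frac1{\sqrt N}\sum_{x\in\mathbb{Z}/N\mathbb{Z}}g(x)\,e\Bigl(-\frac{x\xi}{N}\Bigr),\qquad \xi\in\mathbb{Z}/N\mathbb{Z}.$$ A Dirichlet character $\psi$ modulo $N$ (viewed as a function on $\mathbb{Z}/N\mathbb{Z}$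 vanishing on non-units) is primitive if it has no induced modulus $d<N$; an induced modulus is a divisor $d$ of $N$ such that $\psi(n)=1$ whenever $\gcd(n,N)=1$ and $n\equiv1\pmod d$. *)

(* Defs.v *)
From HB Require Import structures.
From mathcomp Require Import all_boot all_order all_algebra all_fingroup.
From mathcomp Require Import complex.
From mathcomp Require Import all_classical all_reals all_analysis.

Set Implicit Arguments.
Unset Strict Implicit.
Unset Printing Implicit Defensive.

Import Order.TTheory GRing.Theory Num.Theory.

Local Open Scope ring_scope.

Definition e (R : realType) (x : R) : R[i] :=
  (cos (2 * pi * x) +i* sin (2 * pi * x))%C.

(* 'Z_N is Z/NZ only for 1 < N.  Elements of 'Z_N coerce to their
   representatives in [0, N); as e is 1-periodic, the choice of representatives
   does not affect e (- (x * xi / N)). *)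
Definition fourier (R : realType) (N : nat) (g : 'Z_N -> R[i]) (xi : 'Z_N) :
    R[i] :=
  ((Num.sqrt (N%:R : R))^-1)%:C%C *
  \sum_(x : 'Z_N) g x * e (- ((x : nat)%:R * (xi : nat)%:R / N%:R)).

Definition has_order (R : realType) (N : nat) (f : 'Z_N -> R[i]) (m : nat) :
    Prop :=
  [/\ (0 < m)%N,
      forall x : 'Z_N, coprime x N -> m.-unity_root (f x)
    & forall k : nat, (0 < k)%N ->
        (forall x : 'Z_N, coprime x N -> k.-unity_root (f x)) -> (m <= k)%N].

(* The exponent is the representative of c in [0, m), for 1 < m; this is the power f(x)^c
   because f(x) is an m-th root of unity when x is coprime to N. *)
Definition twist (R : realType) (N m : nat) (f : 'Z_N -> R[i])
    (c : {unit 'Z_m}) : 'Z_N -> R[i] :=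
  fun x => if coprime x N then f x ^+ (val c : 'Z_m) else 0.

(* Surjectivity of the reduction H -> (Z/dZ)^*, for 1 < m and d dividing m.
   Residue classes modulo d are given by representatives, since 'Z_1 is not Z/1Z and
   d = 1 must be allowed. *)
Definition reduction_surjective (m d : nat) (H : {set {unit 'Z_m}}) : Prop :=
  forall b : nat, coprime b d ->
    exists2 c : {unit 'Z_m}, c \in H & (val c : 'Z_m) = b %[mod d].

Definition dirichlet_character (R : realType) (N : nat) (psi : 'Z_N -> R[i]) :
    Prop :=
  [/\ psi 1 = 1,
      forall x y : 'Z_N, coprime x N -> coprime y N ->
        psi (x * y) = psi x * psi y
    & forall x : 'Z_N, ~~ coprime x N -> psi x = 0].

Definition induced_modulus (R : realType) (N : nat) (psi : 'Z_N -> R[i])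
    (d : nat) : Prop :=
  (d %| N)%N /\
  forall n : 'Z_N, coprime n N -> n = 1 %[mod d] -> psi n = 1.

Definition primitive_character (R : realType) (N : nat) (psi : 'Z_N -> R[i]) :
    Prop :=
  dirichlet_character psi /\
  ~ exists2 d : nat, (d < N)%N & induced_modulus psi d.

Definition squarefree (n : nat) : Prop :=
  forall k : nat, (k ^ 2 %| n)%N -> k = 1%N.

(* Main.v *)
Require Import Defs.
From HB Require Import structures.
From mathcomp Require Import all_boot all_order all_algebra all_fingroup.
From mathcomp Require Import all_field.
From mathcomp Require Import complex.
From mathcomp Require Import all_classical all_reals all_analysis.
From mathcomp Require Import ring lra zify.

Set Implicit Arguments.
Unset Strict Implicit.
Unset Printing Implicit Defensive.

Import Order.TTheory GRing.Theory Num.Theory.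

Local Open Scope ring_scope.

(**
Write zeta = e(-1/N) and S_c(b) = sum_x f(x)^c zeta^(x b), so that the Fourier
transform of f^c is S_c up to the factor 1/sqrt N.  The values f(b), for b
prime to N, have modulus 1, so the hypothesis on f^c says that

  f(b)^c S_c(b) = S_c(1) != 0    for all b prime to N and all c in H.     (1)

The idea is to compare (1) for different c by Galois conjugation.  Take a prime
to N and choose c in H with c = a mod gcd(m, N), which is possible because H
surjects onto the units modulo gcd(m, N).  Then some k is congruent to c modulo
m and to a modulo N, so the automorphism z |-> z^k of the field generated by
the roots of unity of order lcm(m, N) raises the values of f to the power c and
zeta to the power a.  Applied to (1) with exponent 1, it yields

  f(b)^c S_c(a b) = S_c(a)

([expsum_galois]).  Multiplying by f(a)^c and using (1) at a and at a b gives
f(a)^c f(b)^c = f(a b)^c.  As c is prime to m and f takes values in the m-th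
roots of unity, f(a b) = f(a) f(b) ([self_dual_mulM]): f is a character.  The
automorphism itself is never constructed: all that matters is that a rational
polynomial vanishing at one primitive root of unity of order n vanishes at all
of them ([root_prim_conj]), that is, irreducibility of cyclotomic polynomials.

For primitivity, let d < N divide N and suppose f = 1 on the units congruent to
1 modulo d.  Add up S_1(1 + j d) for j < N/d.  By orthogonality only the x
divisible by N/d contribute, and f vanishes at those; so the sum is 0.  But by
hypothesis it is also a nonzero multiple of the sum of the conjugates of
f(1 + j d), in which every term is 0 or 1 and the term j = 0 is 1
([no_induced_modulus]).

Finally, let m be prime to N.  If k^2 divides N and k > 1, then every unit
n = 1 mod N/k satisfies n^k = 1 mod N, so f(n)^k = f(n)^m = 1 with k prime to
m, and f(n) = 1: N/k would be an induced modulus.  If N is even then N/2 is odd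
by what precedes, and a unit congruent to 1 modulo N/2, being odd, is 1: N/2
would be an induced modulus ([primitive_character_odd_squarefree]).
*)

(** * Conjugate roots of unity *)

(** The cyclotomic polynomial is defined through the algebraic numbers; in other
    fields its roots are found from the factorization of X^n - 1, in which a
    factor of index d < n cannot vanish at a root of unity of exact order n. *)
Lemma root_Cyclotomic (F : numFieldType) (n : nat) (z : F) :
  n.-primitive_root z -> root (map_poly intr 'Phi_n) z.
Proof.
move=> zP; have n_gt0 := prim_order_gt0 zP.
have prodE d : (0 < d)%N ->
    \prod_(k <- divisors d) map_poly intr 'Phi_k = 'X^d - 1 :> {poly F}.
  move=> d_gt0; rewrite -rmorph_prod /= prod_Cyclotomic //.
  by rewrite rmorphB rmorph1 /= map_polyXn.
have : root ('X^n - 1) z.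
  by rewrite rootE !hornerE prim_expr_order // subrr.
rewrite -prodE // /root horner_prod prodf_seq_eq0 => /hasP[d /= d_n /eqP zd0].
rewrite -dvdn_divisors // in d_n.
have d_gt0 := dvdn_gt0 n_gt0 d_n.
have : z ^+ d == 1.
  have /(congr1 (horner^~ z)) := prodE _ d_gt0.
  rewrite horner_prod !hornerE => /esym/eqP.
  rewrite (bigD1_seq d) ?divisors_uniq //=.
    by rewrite zd0 mul0r subr_eq0.
  by rewrite -dvdn_divisors.
rewrite -(prim_order_dvd zP) => n_d.
by rewrite -(eqP (_ : d == n)) ?zd0 // eqn_dvd d_n.
Qed.

(** This is irreducibility over the rationals: a common root with p, which
    exists among the algebraic numbers, has the cyclotomic polynomial as its
    minimal polynomial. *)
Lemma Cyclotomic_dvdp (n : nat) (p : {poly rat}) :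
  (0 < n)%N -> ~~ coprimep p (map_poly intr 'Phi_n) ->
  map_poly intr 'Phi_n %| p.
Proof.
move=> n_gt0; set Q := map_poly intr 'Phi_n => not_co.
have [z zP] := C_prim_root_exists n_gt0.
have QE : map_poly ratr Q = map_poly intr 'Phi_n :> {poly algC}.
  by rewrite -map_poly_comp; apply: eq_map_poly => x /=; rewrite ratr_int.
have [u gu0] : exists u : algC, root (map_poly ratr (gcdp p Q)) u.
  by apply/closed_rootP; rewrite size_map_poly; exact: not_co.
have [pu0 Qu0] : root (map_poly ratr p) u /\ root (map_poly ratr Q) u.
  by move: gu0; rewrite gcdp_map root_gcd => /andP.
have uP : n.-primitive_root u.
  by rewrite -(root_cyclotomic zP) -(Cintr_Cyclotomic zP) -QE.
have [q [qE _ q_dvd]] := minCpolyP u.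
suff -> : Q = q by rewrite -q_dvd.
apply: (map_poly_inj (ratr : rat -> algC)).
by rewrite QE -qE (minCpoly_cyclotomic uP) (Cintr_Cyclotomic uP).
Qed.

(** Primitive roots of unity of the same order are conjugate over the
    rationals.  Transporting polynomial relations from z to w takes the place of
    an automorphism mapping z to w, and makes sense although F need not be a
    Galois extension. *)
Lemma root_prim_conj (F : numFieldType) (n : nat) (z w : F) (p : {poly rat}) :
  n.-primitive_root z -> n.-primitive_root w ->
  root (map_poly ratr p) z -> root (map_poly ratr p) w.
Proof.
move=> zP wP pz0.
have QE :
    map_poly ratr (map_poly intr 'Phi_n) = map_poly intr 'Phi_n :> {poly F}.
  by rewrite -map_poly_comp; apply: eq_map_poly => x /=; rewrite ratr_int.
have [co|/(Cyclotomic_dvdp (prim_order_gt0 zP))] :=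
  boolP (coprimep p (map_poly intr 'Phi_n)).
  have := root_Cyclotomic zP; rewrite -QE.
  rewrite -(coprimep_map (ratr : rat -> F)) in co.
  by rewrite rootE (negPf (coprimep_root co pz0)).
rewrite -(dvdp_map (ratr : rat -> F)) QE => /dvdpP[q ->].
by rewrite rootM root_Cyclotomic ?orbT.
Qed.

(** Monomials suffice: products of values of f and powers of zeta are powers of
    a single root of unity z. *)
Lemma sum_exp_prim_conj (F : numFieldType) (L k : nat) (z : F) (I : finType)
    (P : pred I) (u v : I -> nat) :
  L.-primitive_root z -> coprime k L ->
  \sum_(i | P i) z ^+ u i = \sum_(i | P i) z ^+ v i ->
  \sum_(i | P i) (z ^+ k) ^+ u i = \sum_(i | P i) (z ^+ k) ^+ v i.
Proof.
move=> zP co_kL eq_uv.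
pose p : {poly rat} := \sum_(i | P i) ('X^(u i) - 'X^(v i)).
have hE (x : F) : (map_poly ratr p).[x] =
    \sum_(i | P i) x ^+ u i - \sum_(i | P i) x ^+ v i.
  rewrite rmorph_sum horner_sum -sumrB; apply: eq_bigr => i _.
  by rewrite rmorphB /= !map_polyXn !hornerE.
apply/eqP; rewrite -subr_eq0 -hE.
have wP : L.-primitive_root (z ^+ k) by rewrite prim_root_exp_coprime.
by apply: (root_prim_conj zP wP); rewrite /root hE eq_uv subrr.
Qed.

Lemma chinese_gcd (m N a c : nat) : (0 < m)%N -> (0 < N)%N ->
  c = a %[mod gcdn m N] -> exists2 k, k = c %[mod m] & k = a %[mod N].
Proof.
move=> m_gt0 N_gt0.
wlog le_ca : a c m N m_gt0 N_gt0 / (c <= a)%N => [wl|].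
  move=> eq_ca; have [le_ca|/ltnW le_ac] := leqP c a; first exact: wl.
  have [|k ka kc] := wl c a N m N_gt0 m_gt0 le_ac; first by rewrite gcdnC.
  by exists k.
move/eqP; rewrite eq_sym eqn_mod_dvd // => /dvdnP[q aE].
have [u v uvE _] := egcdnP N m_gt0.
exists (c + u * m * q)%N.
  by rewrite -modnDmr -mulnA mulnC -mulnA modnMr addn0.
have -> : (c + u * m * q)%N = (a + v * q * N)%N.
  by rewrite uvE mulnDl [(gcdn m N * q)%N]mulnC -aE; lia.
by rewrite addnC modnMDl.
Qed.

(** * Exponential sums and Galois conjugation *)

(** The Fourier transform without its normalization and with an abstract root
    of unity.  The frequency b is a natural number rather than a residue class,
    so that multiplying frequencies needs no reduction modulo N. *)
Definition expsum (F : nzRingType) (N : nat) (zeta : F) (g : 'Z_N -> F)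
    (b : nat) : F :=
  \sum_(x : 'Z_N) g x * zeta ^+ (x * b).

(** The relation between S_1(b) and S_1(1) is an identity between sums of powers
    of z; replacing z by z^k, where k = c mod m and k = a mod N, turns it into a
    relation between S_c(a b) and S_c(a). *)
Lemma expsum_galois (F : numFieldType) (N m : nat) (z : F)
    (g : 'Z_N -> F) (b a c : nat) :
  (1 < N)%N -> (0 < c)%N -> (lcmn m N).-primitive_root z ->
  (forall x : 'Z_N, coprime x N -> g x ^+ m = 1) ->
  (forall x : 'Z_N, ~~ coprime x N -> g x = 0) ->
  coprime a N -> coprime c m -> c = a %[mod gcdn m N] ->
  let zeta := z ^+ (lcmn m N %/ N) in
  coprime b N ->
  g b%:R * expsum zeta g b = expsum zeta g 1 ->
  g b%:R ^+ c * expsum zeta (fun x => g x ^+ c) (a * b) =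
    expsum zeta (fun x => g x ^+ c) a.
Proof.
move=> N_gt1 c_gt0 zP g_unity g_zero co_a co_c eq_ca zeta co_b.
have N_gt0 := ltnW N_gt1.
have m_gt0 : (0 < m)%N.
  by have := prim_order_gt0 zP; rewrite lcmn_gt0 => /andP[].
(* z^k plays the role of the conjugate of z. *)
have [k kc ka] := chinese_gcd m_gt0 N_gt0 eq_ca.
have co_k : coprime k (lcmn m N).
  have: coprime k (m * N).
    rewrite coprimeMr -coprime_modl kc coprime_modl co_c.
    by rewrite -coprime_modl ka coprime_modl.
  by apply: coprime_dvdr; rewrite dvdn_lcm dvdn_mulr ?dvdn_mull.
have powmod (u : F) (n i j : nat) :
    u ^+ n = 1 -> i = j %[mod n] -> u ^+ i = u ^+ j.
  by move=> un1 ij; rewrite -(expr_mod i un1) ij expr_mod.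
have zetaN : zeta ^+ N = 1.
  by rewrite -exprM divnK ?dvdn_lcmr // prim_expr_order.
(* A discrete logarithm of g to base z; the default 0 is never used on units. *)
pose l (x : 'Z_N) : nat :=
  if [pick i : 'I_(lcmn m N) | g x == z ^+ i] is Some i then i else 0%N.
have lP (x : 'Z_N) : coprime x N -> g x = z ^+ l x.
  move=> co_x; rewrite /l; case: pickP => [i /eqP //|no].
  have /(prim_rootP zP)[i gi] : g x ^+ lcmn m N = 1.
    by rewrite -(divnK (dvdn_lcml m N)) mulnC exprM g_unity ?expr1n.
  by have := no i; rewrite gi eqxx.
have gk (x : 'Z_N) : coprime x N -> (z ^+ k) ^+ l x = g x ^+ c.
  by move=> co_x; rewrite exprAC -lP //; apply: powmod kc; apply: g_unity.
have zk (i : nat) : (z ^+ k) ^+ (lcmn m N %/ N * i) = zeta ^+ (a * i).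
  rewrite exprAC exprM -/zeta exprM -exprM mulnC exprM.
  by congr (_ ^+ _); apply: powmod ka.
have expsumE (n : nat) (h : 'Z_N -> F) :
    (forall x : 'Z_N, ~~ coprime x N -> h x = 0) ->
    expsum zeta h n = \sum_(x : 'Z_N | coprime x N) h x * zeta ^+ (x * n).
  move=> h0; rewrite /expsum [RHS]big_mkcond; apply: eq_bigr => x _.
  by case: ifPn => // /h0 ->; rewrite mul0r.
have gc0 (x : 'Z_N) : ~~ coprime x N -> g x ^+ c = 0.
  by move=> /g_zero ->; rewrite expr0n gtn_eqF.
have co_b' : coprime (b%:R : 'Z_N) N by rewrite val_Zp_nat // coprime_modl.
rewrite !expsumE // => gE.
pose u x := (l b%:R + (l x + lcmn m N %/ N * (x * b)))%N.
pose v x := (l x + lcmn m N %/ N * (x * 1))%N.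
have /(sum_exp_prim_conj zP co_k) : \sum_(x : 'Z_N | coprime x N) z ^+ u x
    = \sum_(x : 'Z_N | coprime x N) z ^+ v x.
  transitivity (g b%:R * \sum_(x : 'Z_N | coprime x N) g x * zeta ^+ (x * b)).
    rewrite big_distrr; apply: eq_bigr => x co_x.
    by rewrite /u !exprD -!lP // exprM.
  rewrite gE; apply: eq_bigr => x co_x.
  by rewrite /v exprD -lP // [z ^+ (_ * _)]exprM.
rewrite big_distrr => gkE.
transitivity (\sum_(x : 'Z_N | coprime x N) (z ^+ k) ^+ u x).
  by apply: eq_bigr => x co_x; rewrite /u !exprD zk !gk // mulnCA.
rewrite gkE; apply: eq_bigr => x co_x.
by rewrite /v exprD gk // zk muln1 mulnC.
Qed.

Lemma expr_coprime_eq1 (F : nzRingType) (m c : nat) (u : F) :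
  (0 < m)%N -> (0 < c)%N -> coprime c m -> u ^+ m = 1 -> u ^+ c = 1 -> u = 1.
Proof.
move=> m_gt0 c_gt0 co_c um uc.
have [|k k1 k0] := @chinese_gcd m c 0 1 m_gt0 c_gt0.
  by rewrite gcdnC (eqP co_c) !modn1.
rewrite -(expr1 u) -(expr_mod _ um) -k1 (expr_mod _ um).
by rewrite -(expr_mod _ uc) k0 mod0n.
Qed.

Lemma expr_coprime_inj (F : fieldType) (m c : nat) (u v : F) :
  (0 < m)%N -> (0 < c)%N -> coprime c m ->
  u ^+ m = 1 -> v ^+ m = 1 -> u ^+ c = v ^+ c -> u = v.
Proof.
move=> m_gt0 c_gt0 co_c um vm uvc.
have v0 : v != 0.
  apply: contra_eq_neq vm => ->.
  by rewrite expr0n gtn_eqF // eq_sym oner_neq0.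
apply: (mulIf (invr_neq0 v0)); rewrite divff //.
apply: (expr_coprime_eq1 m_gt0 c_gt0 co_c); rewrite expr_div_n.
  by rewrite um vm divr1.
by rewrite uvc divff // expf_neq0.
Qed.

Lemma unity_mul_conj (F : numClosedFieldType) (m : nat) (u : F) :
  (0 < m)%N -> u ^+ m = 1 -> u * u^* = 1.
Proof.
move=> m_gt0 um; rewrite -normCK.
have /eqP : `|u| ^+ m = 1 by rewrite -normrX um normr1.
by rewrite pexpr_eq1 // => /eqP ->; rewrite expr1n.
Qed.

(** Multiplicativity from self-duality of enough powers of g.  The set C of
    exponents only has to meet every class of units modulo gcd(m, N): then each
    unit a modulo N has a c in C such that (a, c) comes from an automorphism of
    the cyclotomic field. *)
Lemma self_dual_mulM (F : numClosedFieldType) (N m : nat) (z : F)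
    (g : 'Z_N -> F) (C : nat -> Prop) :
  (1 < N)%N -> (lcmn m N).-primitive_root z ->
  (forall x : 'Z_N, coprime x N -> g x ^+ m = 1) ->
  (forall x : 'Z_N, ~~ coprime x N -> g x = 0) ->
  g 1 = 1 -> C 1%N ->
  (forall c, C c -> (0 < c)%N /\ coprime c m) ->
  (forall a, coprime a N -> exists2 c, C c & c = a %[mod gcdn m N]) ->
  (forall c, C c -> exists2 mu : F, mu != 0 &
     forall b : nat, expsum (z ^+ (lcmn m N %/ N)) (fun x => g x ^+ c) b =
       mu * (g b%:R ^+ c)^*) ->
  forall x y : 'Z_N, coprime x N -> coprime y N -> g (x * y) = g x * g y.
Proof.
move=> N_gt1 zP g_unity g_zero g1 C1 C_co C_surj eigen x y co_x co_y.
set zeta := z ^+ _ in eigen.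
have m_gt0 : (0 < m)%N.
  by have := prim_order_gt0 zP; rewrite lcmn_gt0 => /andP[].
have co_val (b : nat) : coprime b N -> coprime (b%:R : 'Z_N) N.
  by rewrite val_Zp_nat // coprime_modl.
have unit_pow (b c : nat) : coprime b N -> (g b%:R ^+ c) ^+ m = 1.
  by move=> co_b; rewrite exprAC g_unity ?expr1n //; exact: co_val.
have gauss (c : nat) : C c -> exists2 tau, tau != 0 & forall b, coprime b N ->
    g b%:R ^+ c * expsum zeta (fun x => g x ^+ c) b = tau.
  move=> /eigen[mu mu0 muE]; exists mu => // b co_b.
  by rewrite muE mulrCA (unity_mul_conj m_gt0) ?mulr1 // unit_pow.
have [c Cc eq_c] := C_surj x co_x.
have [c_gt0 co_c] := C_co c Cc.
have [tau tau0 tauE] := gauss c Cc.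
have [tau1 _ tau1E] := gauss 1%N C1.
have gE (b : nat) : coprime b N -> g b%:R * expsum zeta g b = expsum zeta g 1.
  move=> co_b; have := tau1E 1%N (coprime1n _); rewrite expr1 g1 mul1r.
  by have := tau1E b co_b; rewrite expr1 => -> ->.
have co_xy : coprime (x * y)%N N by rewrite coprimeMl co_x.
have := expsum_galois N_gt1 c_gt0 zP g_unity g_zero co_x co_c eq_c co_y
  (gE _ co_y).
rewrite -/zeta => key.
have mulE : (x * y)%N%:R = x * y :> 'Z_N by rewrite natrM !natr_Zp.
apply: (expr_coprime_inj m_gt0 c_gt0 co_c).
- by rewrite -mulE g_unity // co_val.
- by rewrite exprMn !g_unity // mulr1.
have S0 : expsum zeta (fun x => g x ^+ c) (x * y) != 0.
  by apply: contraNneq tau0 => S0; rewrite -(tauE _ co_xy) S0 mulr0.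
(* Both sides, times S_c(x y), equal S_c(1). *)
apply: (mulIf S0); rewrite -mulE tauE // exprMn -mulrA.
by rewrite -{1}[y]natr_Zp key -{1}[x]natr_Zp tauE.
Qed.

(** * Primitivity *)

(** The sum of the values of expsum over the frequencies 1 + j d is computed in
    two ways, once by orthogonality and once by self-duality. *)
Lemma no_induced_modulus (F : numClosedFieldType) (N d : nat) (zeta mu : F)
    (g : 'Z_N -> F) :
  (1 < N)%N -> N.-primitive_root zeta -> mu != 0 ->
  (forall x : 'Z_N, ~~ coprime x N -> g x = 0) ->
  (forall b : nat, expsum zeta g b = mu * (g b%:R)^*) ->
  (d %| N)%N -> (d < N)%N ->
  ~ (forall n : 'Z_N, coprime n N -> n = 1%N %[mod d] -> g n = 1).
Proof.
move=> N_gt1 zP mu0 g_zero eigen d_N lt_dN g_one.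
have N_gt0 := ltnW N_gt1.
have d_gt0 := dvdn_gt0 N_gt0 d_N.
set q := (N %/ d)%N.
have q_gt1 : (1 < q)%N by rewrite ltn_divRL // mul1n.
have NE : N = (q * d)%N by rewrite divnK.
(* For fixed x the sum over j is geometric with ratio zeta^(x d), a root of
   unity of exponent N/d: it vanishes unless N/d divides x, and then x is not a
   unit since N/d > 1. *)
have lhs0 : \sum_(j < q) expsum zeta g (1 + j * d) = 0.
  rewrite exchange_big big1 //= => x _.
  under eq_bigr => j _.
    rewrite mulnDr muln1 exprD mulrA mulnCA mulnC exprM.
  over.
  rewrite -big_distrr /=.
  have [zxd|zxd] := eqVneq (zeta ^+ (x * d)) 1.
    rewrite g_zero ?mul0r //; apply/negP => co_x.
    move/eqP: zxd; rewrite -(prim_order_dvd zP) {1}NE dvdn_pmul2r // => q_x.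
    have := coprime_dvdl q_x co_x.
    rewrite /coprime (gcdn_idPl _) ?NE ?dvdn_mulr //.
    by move=> /eqP q1; rewrite q1 in q_gt1.
  suff -> : \sum_(j < q) (zeta ^+ (x * d)) ^+ j = 0 by rewrite mulr0.
  have zq : (zeta ^+ (x * d)) ^+ q = 1.
    have -> : zeta ^+ (x * d) ^+ q = (zeta ^+ (q * d)) ^+ x.
      by rewrite -!exprM; congr (_ ^+ _); lia.
    by rewrite -NE (prim_expr_order zP) expr1n.
  apply/eqP; have := subrX1 (zeta ^+ (x * d)) q.
  by rewrite zq subrr => /esym/eqP; rewrite mulf_eq0 subr_eq0 (negPf zxd).
suff : \sum_(j < q) expsum zeta g (1 + j * d) != 0 by rewrite lhs0 eqxx.
under eq_bigr => j _ do rewrite eigen.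
rewrite -big_distrr mulf_neq0 //= -rmorph_sum /= conjC_eq0.
have gE (j : nat) : g (1 + j * d)%N%:R = (coprime (1 + j * d) N)%:R.
  have [co|nco] := boolP (coprime (1 + j * d) N); last first.
    by rewrite g_zero // val_Zp_nat // coprime_modl.
  rewrite g_one //; first by rewrite val_Zp_nat // coprime_modl.
  by rewrite val_Zp_nat // modn_dvdm // addnC modnMDl.
under eq_bigr => j _ do rewrite gE.
rewrite -natr_sum pnatr_eq0 -lt0n (bigD1 (Ordinal (ltnW q_gt1))) //=.
by rewrite mul0n addn0 coprime1n.
Qed.

(** * Characters of order prime to the modulus *)

Lemma exp1D_sqr0 (A : comNzRingType) (u : A) (k : nat) :
  u ^+ 2 = 0 -> (1 + u) ^+ k = 1 + u *+ k.
Proof.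
rewrite expr2 => uu0; elim: k => [|k IHk]; first by rewrite expr0 addr0.
rewrite exprS IHk mulrDl mul1r mulrDr mulr1 mulrnAr uu0 mul0rn addr0.
by rewrite mulrS addrAC -addrA.
Qed.

Lemma Zp_nat_eq0 (N a : nat) : (1 < N)%N -> (N %| a)%N -> a%:R = 0 :> 'Z_N.
Proof. by move=> N_gt1 /eqP Na; apply: val_inj; rewrite /= val_Zp_nat. Qed.

Lemma Zp_coprime_gt0 (N : nat) (n : 'Z_N) :
  (1 < N)%N -> coprime n N -> (0 < n)%N.
Proof.
move=> N_gt1 co_n; rewrite lt0n; apply: contraTneq co_n => ->.
by rewrite /coprime gcd0n gtn_eqF.
Qed.

Lemma Zp_unitE (N : nat) (n : 'Z_N) :
  (1 < N)%N -> coprime n N -> n = 1 + (n.-1)%:R.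
Proof.
move=> N_gt1 /(Zp_coprime_gt0 N_gt1) n_gt0.
by rewrite -[1]/(1%:R) -natrD add1n prednK // natr_Zp.
Qed.

Lemma dirichlet_character_exp (R : realType) (N : nat) (psi : 'Z_N -> R[i])
    (n : 'Z_N) (k : nat) :
  (1 < N)%N -> dirichlet_character psi -> coprime n N ->
  coprime (n ^+ k : 'Z_N) N /\ psi (n ^+ k) = psi n ^+ k.
Proof.
move=> N_gt1 [psi1 psiM _] co_n; elim: k => [|k [co_nk IHk]].
  by rewrite !expr0 -[1]/(1%:R) val_Zp_nat // coprime_modl coprime1n.
have co_nk1 : coprime (n ^+ k.+1 : 'Z_N) N.
  have -> : n ^+ k.+1 = ((n : nat) * (n ^+ k : 'Z_N))%N%:R.
    by rewrite natrM !natr_Zp exprS.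
  by rewrite val_Zp_nat // coprime_modl coprimeMl co_n.
by split; rewrite // !exprS psiM // IHk.
Qed.

(** A character whose order is prime to N is trivial on the units of exponent
    dividing N, in particular on the kernel of reduction modulo N/k when k^2
    divides N. *)
Lemma primitive_character_odd_squarefree (R : realType) (N m : nat)
    (psi : 'Z_N -> R[i]) :
  (1 < N)%N -> (0 < m)%N -> primitive_character psi ->
  (forall x : 'Z_N, coprime x N -> psi x ^+ m = 1) ->
  coprime m N -> odd N /\ squarefree N.
Proof.
move=> N_gt1 m_gt0 [psiP psi_prim] psi_unity co_mN.
have N_gt0 := ltnW N_gt1.
have dvd_pred (n : 'Z_N) (d : nat) :
    coprime n N -> n = 1%N %[mod d] -> (d %| n.-1)%N.
  by move=> co_n /eqP; rewrite eqn_mod_dvd ?subn1 // Zp_coprime_gt0.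
have sqfree : squarefree N.
  move=> k kk_N; apply/eqP/negPn/negP => k_neq1; apply: psi_prim.
  have k_gt0 : (0 < k)%N by case: k kk_N {k_neq1} => //; rewrite dvd0n gtn_eqF.
  have k_N : (k %| N)%N by apply: dvdn_trans kk_N; rewrite dvdn_exp.
  exists (N %/ k)%N; first by rewrite ltn_Pdiv // ltn_neqAle eq_sym k_neq1.
  split; first exact: dvdn_div.
  move=> n co_n /(dvd_pred _ _ co_n)/dvdnP[t nE].
  have n1 := Zp_unitE N_gt1 co_n.
  have u2 : (n.-1%:R : 'Z_N) ^+ 2 = 0.
    rewrite -natrX Zp_nat_eq0 // nE expnMn dvdn_mull //.
    have /dvdnP[s NE] := kk_N.
    have -> : (N %/ k)%N = (s * k)%N by rewrite NE -mulnn mulnA mulnK.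
    by rewrite NE expnMn dvdn_mul // dvdn_exp.
  have uk : (n.-1%:R : 'Z_N) *+ k = 0.
    by rewrite -mulrnA Zp_nat_eq0 // nE -mulnA divnK // dvdn_mull.
  have nk : n ^+ k = 1 by rewrite n1 exp1D_sqr0 // uk addr0.
  apply: (expr_coprime_eq1 m_gt0 k_gt0); last 1 first.
  - have [_ <-] := dirichlet_character_exp k N_gt1 psiP co_n.
    by rewrite nk; case: psiP.
  - by rewrite coprime_sym; exact: coprime_dvdr k_N co_mN.
  - exact: psi_unity.
split=> //; apply/negPn/negP; rewrite -dvdn2 => two_N; apply: psi_prim.
have NE : N = (N %/ 2 * 2)%N by rewrite divnK.
exists (N %/ 2)%N; first by rewrite ltn_Pdiv.
split; first exact: dvdn_div.
move=> n co_n /(dvd_pred _ _ co_n) M_n.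
have co_M2 : coprime (N %/ 2) 2.
  rewrite coprimen2; apply/negP => /negP; rewrite -dvdn2 => two_M.
  suff /sqfree : (2 ^ 2 %| N)%N by [].
  by rewrite NE dvdn_mul.
have : (N %| n.-1)%N.
  have -> k : (N %| k)%N = (N %/ 2 %| k)%N && (2 %| k)%N.
    by rewrite {1}NE Gauss_dvd.
  rewrite M_n dvdn2 /=.
  have : odd n by rewrite -coprimen2; exact: coprime_dvdr two_N co_n.
  by case: (n : nat) => //= k; rewrite negbK.
move=> /(Zp_nat_eq0 N_gt1) n0.
have -> : n = 1; last by case: psiP.
by rewrite (Zp_unitE N_gt1 co_n) n0 addr0.
Qed.

(** * The root of unity of the Fourier transform *)

Lemma e_exp (R : realType) (x : R) (n : nat) : e x ^+ n = e (n%:R * x).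
Proof.
elim: n => [|n IHn]; first by rewrite mul0r /e mulr0 cos0 sin0 expr0.
have xE : 2 * pi * (n.+1%:R * x) = 2 * pi * x + 2 * pi * (n%:R * x).
  by rewrite -[n.+1%:R]natr1; ring.
rewrite exprS IHn /e xE.
rewrite cosD sinD; apply/eqP.
by rewrite eq_complex /= [X in _ && (_ == X)]addrC !eqxx.
Qed.

(** The half-angle formula cos (2 t) = 1 - 2 sin(t)^2, with 0 < t < pi. *)
Lemma eN_neq1 (R : realType) (x : R) : 0 < x < 1 -> e (- x) != 1.
Proof.
move=> /andP[x_gt0 x_lt1]; rewrite eq_complex negb_and /=; apply/orP; left.
have -> : 2 * pi * - x = - ((pi * x) *+ 2) by rewrite mulr2n; ring.
rewrite cosN cos_mulr2n cos2sin2 /=.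
have s_gt0 : 0 < sin (pi * x).
  by apply: sin_gt0_pi; rewrite mulr_gt0 ?pi_gt0 //= gtr_pMr ?pi_gt0.
by have s2 := exprn_gt0 2 s_gt0; apply/eqP; lra.
Qed.

Lemma e_inv_prim (R : realType) (n : nat) :
  (0 < n)%N -> n.-primitive_root (e (- n%:R^-1) : R[i]).
Proof.
move=> n_gt0; have n0 : (n%:R : R) != 0 by rewrite pnatr_eq0 -lt0n.
apply/andP; split=> //; apply/forallP => i; apply/eqP.
rewrite unity_rootE e_exp.
have [->|ne] := eqVneq i.+1 n.
  rewrite mulrN divff // /e mulrN1.
  by rewrite eq_complex /= cosN sinN mulr_natl cos2pi sin2pi oppr0 !eqxx.
apply: negPf; rewrite mulrN; apply: eN_neq1.
have lt_in : (i.+1 < n)%N by rewrite ltn_neqAle ne ltn_ord.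
by rewrite divr_gt0 ?ltr0n //= ltr_pdivrMr ?ltr0n // mul1r ltr_nat.
Qed.

Lemma expsum_of_fourier (R : realType) (N : nat) (g : 'Z_N -> R[i])
    (lambda : R[i]) :
  (1 < N)%N -> lambda != 0 -> (forall xi, fourier g xi = lambda * (g xi)^*) ->
  exists2 mu, mu != 0 &
    forall b : nat, expsum (e (- N%:R^-1)) g b = mu * (g b%:R)^*.
Proof.
move=> N_gt1 l0 eigen.
have N_gt0 := ltnW N_gt1.
set w := ((Num.sqrt (N%:R : R))^-1)%:C%C.
have w0 : w != 0.
  by rewrite fmorph_eq0 invr_eq0 sqrtr_eq0 -ltNge ltr0n.
exists (lambda / w); first by rewrite mulf_neq0 ?invr_eq0.
move=> b; apply: (mulfI w0); rewrite mulrA mulrCA divff // mulr1 -eigen.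
rewrite /fourier -/w; congr (_ * _); apply: eq_bigr => x _; congr (_ * _).
rewrite -(expr_mod _ (prim_expr_order (e_inv_prim R N_gt0))).
rewrite val_Zp_nat // -modnMmr.
rewrite (expr_mod _ (prim_expr_order (e_inv_prim R N_gt0))) e_exp natrM.
by congr (e _); rewrite mulrN.
Qed.

(** * The theorem *)

Theorem theorem1p5 (R : realType) (N m : nat) (f : 'Z_N -> R[i])
    (H : {group {unit 'Z_m}}) :
  (1 < N)%N -> (1 < m)%N ->
  (forall x : 'Z_N, f x = 0 \/ m.-unity_root (f x)) ->
  has_order f m ->
  f 1 = 1 ->
  (forall n : 'Z_N, f n = 0 <-> (1 < gcdn n N)%N) ->
  reduction_surjective (gcdn m N) H ->
  (forall c : {unit 'Z_m}, c \in H ->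
    exists2 lambda : R[i], lambda != 0 &
      forall xi : 'Z_N, fourier (twist f c) xi = lambda * (twist f c xi)^*) ->
  primitive_character f /\ (coprime m N -> odd N /\ squarefree N).
Proof.
move=> N_gt1 m_gt1 _ [m_gt0 f_unity _] f1 f0 H_surj eigen.
have N_gt0 := ltnW N_gt1.
have f_zero (x : 'Z_N) : ~~ coprime x N -> f x = 0.
  move=> nco; apply/f0; rewrite ltn_neqAle eq_sym nco.
  by rewrite gcdn_gt0 N_gt0 orbT.
have f_unit (x : 'Z_N) : coprime x N -> f x ^+ m = 1.
  by move=> /f_unity; rewrite unity_rootE => /eqP.
pose C (c : nat) :=
  exists2 u : {unit 'Z_m}, u \in H & c = (val u : 'Z_m) :> nat.
have C_co (c : nat) : C c -> (0 < c)%N /\ coprime c m.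
  move=> [u _ ->].
  have co_u : coprime (val u : 'Z_m) m.
    by have := valP u; rewrite -{1}[val u]natr_Zp unitZpE // coprime_sym.
  split=> //; rewrite lt0n; apply: contraTneq co_u => ->.
  by rewrite /coprime gcd0n gtn_eqF.
have C1 : C 1%N.
  by exists 1%g; rewrite ?group1 //= -[1]/(1%:R) val_Zp_nat // modn_small.
have C_surj a : coprime a N -> exists2 c, C c & c = a %[mod gcdn m N].
  move=> co_a; have [|u uH u_a] := H_surj a.
    by apply: coprime_dvdr co_a; apply: dvdn_gcdr.
  by exists (val u : 'Z_m) => //; exists u.
have L_gt0 : (0 < lcmn m N)%N by rewrite lcmn_gt0 m_gt0.
(* A common generator of the roots of unity of orders m and N, chosen so that
   its power of order N is exactly the root of unity e(-1/N) in the Fourier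
   transform. *)
have zP := e_inv_prim R L_gt0.
set z := e _ in zP.
have zE : z ^+ (lcmn m N %/ N) = e (- N%:R^-1).
  rewrite /z e_exp; congr (e _).
  have {2}-> : lcmn m N = (lcmn m N %/ N * N)%N by rewrite divnK // dvdn_lcmr.
  have L0 : ((lcmn m N %/ N)%N%:R : R) != 0.
    by rewrite pnatr_eq0 -lt0n divn_gt0 // dvdn_leq ?dvdn_lcmr.
  have N0 : (N%:R : R) != 0 by rewrite pnatr_eq0 -lt0n.
  by rewrite natrM mulrN invfM mulrA divff // mul1r.
have eigenC c : C c -> exists2 mu : R[i], mu != 0 &
    forall b : nat, expsum (e (- N%:R^-1)) (fun x => f x ^+ c) b =
      mu * (f b%:R ^+ c)^*.
  move=> Cc; have [c_gt0 _] := C_co c Cc; case: Cc => u uH cE.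
  have [l l0 lE] := eigen u uH.
  have twistE (x : 'Z_N) : twist f u x = f x ^+ c.
    rewrite /twist cE; case: ifPn => // /f_zero ->.
    by rewrite expr0n -cE gtn_eqF.
  apply: (expsum_of_fourier N_gt1 l0) => xi; rewrite -twistE -lE.
  by rewrite /fourier; congr (_ * _); apply: eq_bigr => x _; rewrite twistE.
have f_char : dirichlet_character f.
  split=> // x y.
  apply: (self_dual_mulM N_gt1 zP f_unit f_zero f1 C1 C_co C_surj).
  by rewrite zE.
have f_prim : primitive_character f.
  split=> // -[d lt_dN [d_N f_one]].
  have [mu mu0 muE] := eigenC 1%N C1.
  apply: (no_induced_modulus N_gt1 (e_inv_prim R N_gt0) mu0 f_zero _
            d_N lt_dN f_one).
  exact: muE.
split=> // co_mN.
exact: (primitive_character_odd_squarefree N_gt1 m_gt0 f_prim f_unit).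
Qed.
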